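(* Let $\mathcal G$ be a real Markov topograph with labels in $(2,\infty)$ and discriminator $D\ne4$. For any triple $(r,s,t)$ of $\mathcal G$ we have $$\sum_{m\in\mathcal G}h_{r,s,t}(m)\cdot\log\left(1-\frac{D-4}{m^2-4}\right)=\rho(r)+\rho(s)+\rho(t),$$ where the sum is over all regions of $\mathcal G$; each region has label $m$ and height $h_{r,s,t}(m)$.
   Context: A real Markov topograph $\mathcal G$ is an infinite 3-regular tree drawn in the plane, with a real label on every complementary region, such that for every edge, with regions $s,t$ on its two sides and regions $r,u$ at its two ends, $r+u=st$. A triple $(r,s,t)$ of $\mathcal G$ consists of the labels of the three regions meeting at a vertex, listed in clockwise order. The discriminator is $D=r^2+s^2+t^2-rst$ for any triple (it is independent of the triple). Height: fix the vertex $v$ at which the regions $r,s,t$ meet. The height from $v$ of each of these three regions is $1$, and inductively, for an edge $e$ directed away from $v$, the region pointed to by $e$ (at its far end) has height equal to the sum of the heights of the two regions on the sides of $e$. The height of a region labeled $m$ is written $h_{r,s,t}(m)$ (it depends on the region, not only on the label; labels may repeat and the sum is over regions). $\rho(x)=\cosh^{-1}(x/2)=\log\frac{x+\sqrt{x^2-4}}2$ for $x\ge2$. *)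

(* Defs.v *)
From HB Require Import structures.
From Stdlib Require Import Relation_Operators.
From mathcomp Require Import all_boot all_order all_algebra.
From mathcomp Require Import all_classical all_reals all_analysis.
From mathcomp Require summability.

Set Implicit Arguments.
Unset Strict Implicit.
Unset Printing Implicit Defensive.

Import Order.TTheory GRing.Theory Num.Theory.
Import numFieldNormedType.Exports.

Local Open Scope classical_set_scope.
Local Open Scope ring_scope.

(* A 3-regular tree drawn in the plane, as a rotation system: [nbr v 0],
   [nbr v 1], [nbr v 2] are the neighbours of [v] in clockwise order (indices
   are read modulo 3, the choice of the first neighbour being immaterial).
   [i + 1] and [i - 1] below are cyclic, in the ring structure of ['I_3].
   Such a tree is infinite as soon as it has a vertex. *)
Definition adjacent (V : eqType) (nbr : V -> 'I_3 -> V) : rel V :=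
  fun v w => [exists i, nbr v i == w].

Record planar_cubic_tree := PlanarCubicTree {
  vertex : choiceType;
  nbr : vertex -> 'I_3 -> vertex;
  nbr_inj : forall v, injective (nbr v);
  nbr_irr : forall v i, nbr v i != v;
  nbr_sym : symmetric (adjacent nbr);
  nbr_tree : forall v w : vertex, exists! p : seq vertex,
    [&& path (adjacent nbr) v p, uniq (v :: p) & last v p == w]
}.

Section Regions.
Variable T : planar_cubic_tree.

(* The corner [(v, i)] is the sector at [v] opposite to the edge towards
   [nbr v i], i.e. between the edges towards [nbr v (i + 1)] and
   [nbr v (i - 1)]. *)
Definition corner : choiceType := (vertex T * 'I_3)%type.

(* The two corners lying on the same side of an edge, at its two ends: if
   [w = nbr v i] and [v = nbr w j], the side on the left when going from [v] to
   [w] consists of the corners [(v, i + 1)] and [(w, j - 1)]. *)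
Inductive same_side : corner -> corner -> Prop :=
| SameSide (v w : vertex T) (i j : 'I_3) :
    nbr v i = w -> nbr w j = v -> same_side (v, i + 1) (w, j - 1).

Definition face (c : corner) : set corner :=
  [set c' | clos_refl_sym_trans corner same_side c c'].

(* The complementary regions, each one given by its set of corners. *)
Definition region : choiceType := {A : set corner | A \in range face}.

Definition region_at (v : vertex T) (i : 'I_3) : region :=
  exist _ (face (v, i)) (mem_set (imageP face (I : [set: corner] (v, i)))).

(* The edge from [v] to [w] is directed away from [v0]: it is the last edge of
   a simple path starting at [v0]. *)
Definition away (v0 v w : vertex T) : Prop :=
  exists p : seq (vertex T),
    [/\ path (adjacent (@nbr T)) v0 (rcons p w),
        uniq (v0 :: rcons p w) & last v0 p = v].

Inductive has_height (v0 : vertex T) : region -> nat -> Prop :=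
| HeightBase (i : 'I_3) : has_height v0 (region_at v0 i) 1
| HeightStep (v w : vertex T) (i j : 'I_3) (a b : nat) :
    nbr v i = w -> nbr w j = v -> away v0 v w ->
    has_height v0 (region_at v (i + 1)) a ->
    has_height v0 (region_at v (i - 1)) b ->
    has_height v0 (region_at w j) (a + b).

(* Every region has exactly one height, so the default value 0 is not used. *)
Definition height (v0 : vertex T) (m : region) : nat :=
  xget 0%N [set n | has_height v0 m n].

End Regions.

Record real_markov_topograph (R : realType) := RealMarkovTopograph {
  tree :> planar_cubic_tree;
  label : region tree -> R;
  label_edge : forall (v w : vertex tree) (i j : 'I_3),
    nbr v i = w -> nbr w j = v ->
    label (region_at v i) + label (region_at w j) =
    label (region_at v (i + 1)) * label (region_at v (i - 1))
}.

Section Topographs.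
Variables (R : realType) (G : real_markov_topograph R).

Definition triple_at (v : vertex G) (r s t : R) : Prop :=
  exists i : 'I_3, [/\ r = label (region_at v i),
                       s = label (region_at v (i + 1))
                     & t = label (region_at v (i - 1))].

(* The value does not depend on the triple used to compute it. *)
Definition is_discriminator (D : R) : Prop :=
  exists (v : vertex G) (r s t : R),
    triple_at v r s t /\ D = r ^+ 2 + s ^+ 2 + t ^+ 2 - r * s * t.

End Topographs.

Definition rho (R : realType) (x : R) : R :=
  ln ((x + Num.sqrt (x ^+ 2 - 4)) / 2).

(* Unordered sum: the net of the sums over finite subsets of [I], directed by
   inclusion, converges to [l]. *)
Definition has_sum (I : choiceType) (R : realType) (x : I -> R) (l : R) : Prop :=
  summability.partial_sum x @ summability.totally --> l.

(* Main.v *)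
(** Let K = 4 - D, lam x = exp (rho x), and let x_n be the labels of the regions around
   a region s, so that x_n = A (lam s)^n + B (lam s)^-n with AB = 1 + K/(s^2-4); thus
   the logarithm attached to s is log A + log B.  An edge with sides s, t pointing to u
   carries the weights phi s t u = rho t - log A (A being read off from x_0 = t, x_1 = u)
   and phi t s u, and h_s phi s t u + h_t phi t s u telescopes: it is the term of u plus
   the same expressions at the two edges that follow.  At the root the expressions
   add up to rho r + rho s + rho t, so everything rests on the sum over the edges
   at distance n tending to 0.

   Following an edge downhill decreases r + s + t by an amount bounded below as long as
   D <> 4, so the descent ends at a sink, where D < 4 is read off; hence all terms are
   nonnegative and, from some distance on, all edges go uphill.  Uphill one has
   phi s t u <= 4K/((s^2-4)(t^2-4)) <= C log (1 + K/(u^2-4)), i.e. the remainders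
   satisfy R_n <= C (R_n - R_{n+1}), which forces R_n to tend to 0. *)
Require Import Defs.
From mathcomp Require Import all_boot all_order all_algebra.
From mathcomp Require Import all_classical all_reals all_analysis.
From mathcomp Require Import finmap ring lra.
From mathcomp Require summability.
Import Order.TTheory GRing.Theory Num.Theory.
Local Open Scope ring_scope.

Set Implicit Arguments.
Unset Strict Implicit.
Unset Printing Implicit Defensive.

(** * Regions and heights in a planar cubic tree *)

Lemma I3_addNN (i : 'I_3) : i - 1 - 1 = i + 1.
Proof. by case: i => [[|[|[|]]]] //= ?; apply/val_inj. Qed.

Lemma I3_addDD (i : 'I_3) : i + 1 + 1 = i - 1.
Proof. by case: i => [[|[|[|]]]] //= ?; apply/val_inj. Qed.

Lemma I3_add1_neq (i : 'I_3) : (i + 1 == i) = false.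
Proof. by case: i => [[|[|[|]]]]. Qed.

Lemma I3_sub1_neq (i : 'I_3) : (i - 1 == i) = false.
Proof. by case: i => [[|[|[|]]]]. Qed.

Lemma I3_sub1_add1 (i : 'I_3) : (i - 1 == i + 1) = false.
Proof. by case: i => [[|[|[|]]]]. Qed.

Lemma I3_cases (i j : 'I_3) : [\/ j = i, j = i + 1 | j = i - 1].
Proof.
case: i => [[|[|[|]]]] //= ?; case: j => [[|[|[|]]]] //= ?;
by [constructor 1; apply/val_inj|constructor 2; apply/val_inj|constructor 3; apply/val_inj].
Qed.

Section Combinatorics.
Variable T : planar_cubic_tree.
Implicit Types (x w : vertex T) (c d : corner T).
Notation adj := (Defs.adjacent (@nbr T)).

Lemma adjP x w : reflect (exists i, nbr x i = w) (adj x w).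
Proof. by apply: (iffP existsP) => -[i /eqP]; exists i => //; apply/eqP. Qed.

(* A corner [(w, i)] also stands for the edge directed from [w] to [nbr w i], with
   [left] and [right] giving its two sides. *)
Lemma rev_ex d : exists e : corner T, e.1 = nbr d.1 d.2 /\ nbr e.1 e.2 = d.1.
Proof.
have /adjP[j jE] : adj (nbr d.1 d.2) d.1 by rewrite nbr_sym; apply/adjP; exists d.2.
by exists (nbr d.1 d.2, j).
Qed.

Definition rev d : corner T := sval (cid (rev_ex d)).

Lemma rev1 d : (rev d).1 = nbr d.1 d.2.
Proof. by rewrite /rev; case: cid => e []. Qed.

Lemma nbr_rev d : nbr (rev d).1 (rev d).2 = d.1.
Proof. by rewrite /rev; case: cid => e []. Qed.

Lemma revE x w i j : nbr x i = w -> nbr w j = x -> rev (x, i) = (w, j).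
Proof.
move=> xi wj; have := nbr_rev (x, i); rewrite [RHS]/= rev1 /= xi => h.
rewrite [LHS]surjective_pairing rev1 /= xi; congr pair.
by apply: (@nbr_inj T w); rewrite h wj.
Qed.

Lemma revK : involutive rev.
Proof. by case=> x i; rewrite [rev (x, i)]surjective_pairing; apply: revE; rewrite ?nbr_rev ?rev1. Qed.

Definition reg c : region T := region_at c.1 c.2.

Lemma reg_eq c c' : reg c = reg c' <-> Relation_Operators.clos_refl_sym_trans _ (@same_side T) c c'.
Proof.
case: c c' => [x i] [y j]; split=> [|h].
  move=> /(congr1 sval)/= e; have : face (y, j) (y, j) by apply: Relation_Operators.rst_refl.
  by rewrite -e.
have e : face (x, i) = face (y, j).
  apply/seteqP; split=> z; rewrite /face/= => h'.
    apply: Relation_Operators.rst_trans h'; exact: Relation_Operators.rst_sym.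
  exact: Relation_Operators.rst_trans h'.
by apply: val_inj.
Qed.

Definition left d : corner T := (d.1, d.2 + 1).
Definition right d : corner T := (d.1, d.2 - 1).

Lemma reg_left d : reg (left d) = reg (right (rev d)).
Proof.
apply/reg_eq; apply: Relation_Operators.rst_step.
by apply: SameSide; rewrite ?rev1 //= -rev1; apply: nbr_rev.
Qed.

Lemma reg_right d : reg (right d) = reg (left (rev d)).
Proof. by have := reg_left (rev d); rewrite revK. Qed.

(** Of the two edges following [d], the one that keeps the left side of [d] on its left; read as a
    corner, it lies in the region to the right of [d]. [succr] is its mirror image. *)
Definition succl d : corner T := left (rev d).
Definition succr d : corner T := right (rev d).

Lemma right_left d : right (left d) = d.
Proof. by rewrite /right /= addrK -surjective_pairing. Qed.

Lemma left_right d : left (right d) = d.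
Proof. by rewrite /left /= subrK -surjective_pairing. Qed.

Lemma left_left d : left (left d) = right d.
Proof. by rewrite /left /= I3_addDD. Qed.

Lemma right_right d : right (right d) = left d.
Proof. by rewrite /right /= I3_addNN. Qed.

Lemma reg_left_succl d : reg (left (succl d)) = reg (left d).
Proof. by rewrite left_left reg_left. Qed.

Lemma reg_right_succr d : reg (right (succr d)) = reg (right d).
Proof. by rewrite right_right reg_right. Qed.

Lemma succl_inj : injective succl.
Proof. exact: inj_comp (can_inj right_left) (can_inj revK). Qed.

Lemma succr_inj : injective succr.
Proof. exact: inj_comp (can_inj left_right) (can_inj revK). Qed.

(** * Simple paths from a base vertex and edges directed away from it *)

Variable v : vertex T.

Definition spath w : seq (vertex T) := sval (cid (nbr_tree v w)).

Lemma spathP w : [&& path adj v (spath w), uniq (v :: spath w) & last v (spath w) == w].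
Proof. by rewrite /spath; case: cid => p []. Qed.

Lemma spath_uniq w p : path adj v p -> uniq (v :: p) -> last v p = w -> spath w = p.
Proof.
move=> h1 h2 /eqP h3; rewrite /spath; case: cid => q [_] /=.
by apply; apply/and3P.
Qed.

Lemma spath_root : spath v = [::].
Proof. exact: spath_uniq. Qed.

(** If [w] is not on the path to [x], that path extends to [w]. Otherwise its part beyond [w] is a
    simple path from [w] to [x], hence by uniqueness the single edge. *)
Lemma spath_adj x w : adj x w ->
  spath w = rcons (spath x) w \/ spath x = rcons (spath w) x.
Proof.
move=> xw; have /and3P[px ux /eqP lx] := spathP x.
have [win|wnin] := boolP (w \in v :: spath x); last first.
  left; apply: spath_uniq.
  - by rewrite rcons_path px lx.
  - by rewrite -rcons_cons rcons_uniq wnin.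
  - by rewrite last_rcons.
right; move: px ux lx win; move: (spath x) => p px ux lx win.
case/splitPl: win px ux lx => p1 p2 l1; rewrite cat_path => /andP[pp1 pp2].
rewrite last_cat l1 -cat_cons cat_uniq => /and3P[u1 n2 u2] l2.
have -> : spath w = p1 by exact: spath_uniq.
rewrite l1 in pp2.
have xNw : x != w by case/adjP: xw => i <-; rewrite eq_sym nbr_irr.
have [q [_ hq]] := nbr_tree w x.
rewrite -cats1; congr cat.
rewrite -(hq p2); last first.
  rewrite pp2 /= u2 l2 eqxx !andbT; apply/negP => wp2; move/hasPn: n2 => /(_ _ wp2).
  by rewrite /= -l1 mem_last.
apply: hq; rewrite /= nbr_sym xw !inE eq_sym xNw eqxx //.
Qed.

Definition awayd d := spath (nbr d.1 d.2) == rcons (spath d.1) (nbr d.1 d.2).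

Lemma awayP x i : reflect (away v x (nbr x i)) (awayd (x, i)).
Proof.
apply: (iffP eqP) => /= [e|[p [pp up lp]]].
  exists (spath x); rewrite -e; have /and3P[? ? _] := spathP (nbr x i); split=> //.
  by have /and3P[_ _ /eqP] := spathP x.
rewrite (@spath_uniq (nbr x i) (rcons p (nbr x i))) ?last_rcons //; congr rcons.
apply/esym/spath_uniq => //; first by move: pp; rewrite rcons_path => /andP[].
by move: up; rewrite -rcons_cons rcons_uniq => /andP[].
Qed.

Lemma awayd_rev d : awayd (rev d) = ~~ awayd d.
Proof.
rewrite /awayd nbr_rev rev1.
have /spath_adj : adj d.1 (nbr d.1 d.2) by apply/adjP; exists d.2.
have rn (p : seq (vertex T)) y z : (p == rcons (rcons p y) z) = false.
  by apply/negbTE/eqP => /(congr1 size); rewrite !size_rcons; elim: size => // k IHk [].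
by case=> ->; rewrite eqxx ?rn // negbK.
Qed.

Lemma awayd_root i : awayd (v, i).
Proof.
rewrite /awayd/= spath_root /=.
apply/eqP/spath_uniq; rewrite //= ?inE 1?eq_sym ?nbr_irr //.
by rewrite andbT; apply/adjP; exists i.
Qed.

(** An edge at [w] that does not lead away ends at the vertex preceding [w] on the simple path from
    [v]. *)
Lemma parent_uniq w j j' : ~~ awayd (w, j) -> ~~ awayd (w, j') -> j = j'.
Proof.
have key k : ~~ awayd (w, k) -> spath w = rcons (spath (nbr w k)) w.
  by rewrite -awayd_rev /awayd nbr_rev rev1 => /eqP.
move=> /key e /key; rewrite e => /rcons_inj[e'].
apply: (@nbr_inj T w).
have /and3P[_ _ /eqP <-] := spathP (nbr w j).
by rewrite e'; have /and3P[_ _ /eqP ->] := spathP (nbr w j').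
Qed.

Lemma parent_ex w : w != v -> exists j, ~~ awayd (w, j).
Proof.
move=> wv; have /and3P[pw uw /eqP lw] := spathP w.
move: pw uw lw; move e : (spath w) => q; case/lastP: q e => [|p y] e pw uw lw.
  by rewrite -lw /= eqxx in wv.
move: lw; rewrite last_rcons => yw; subst y.
move: pw; rewrite rcons_path => /andP[pp].
rewrite nbr_sym => /adjP[j jE]; exists j.
rewrite -awayd_rev /awayd nbr_rev rev1 /= jE e.
apply/eqP; congr rcons; apply/esym/spath_uniq => //.
by move: uw; rewrite -rcons_cons rcons_uniq => /andP[].
Qed.

(** * The corner of a region nearest to the base vertex *)

(** Away from [v], a region begins where the edge opposite to its corner leads back towards [v]: it
    is the region which that edge, reversed, points to. *)
Definition isroot c := (c.1 == v) || ~~ awayd c.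

(** The default 0 occurs only at [v], whose corners are all fixed by [up]. *)
Definition pdir w := odflt 0 [pick j | ~~ awayd (w, j)].

Lemma pdirE w j : ~~ awayd (w, j) -> pdir w = j.
Proof.
rewrite /pdir => h; case: pickP => [k /parent_uniq/(_ h) //|/(_ j)].
by rewrite h.
Qed.

(* One step towards [v] along the boundary of the region of [c], unless [c] is the corner
   of its region that is nearest to [v]; so [root c] depends only on the region of [c]. *)
Definition up c : corner T :=
  if isroot c then c else
  let d := rev (c.1, pdir c.1) in
  if c.2 == pdir c.1 + 1 then right d else left d.

Lemma up_left d : awayd d -> up (right (rev d)) = left d.
Proof.
move=> a; have rn : ~~ awayd (rev d) by rewrite awayd_rev a.
have pE : pdir (rev d).1 = (rev d).2 by apply: pdirE; rewrite -surjective_pairing.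
have rv : (rev d).1 != v.
  by apply/eqP => e; move: rn; rewrite [rev d]surjective_pairing e awayd_root.
rewrite /up /isroot /= (negbTE rv) /=; case: ifP => [/negP h|_].
  exfalso; have := @parent_uniq (rev d).1 (rev d).2 ((rev d).2 - 1).
  rewrite -surjective_pairing; move/negP: h => h /(_ rn h) /eqP.
  by rewrite eq_sym I3_sub1_neq.
by rewrite pE I3_sub1_add1 -surjective_pairing revK.
Qed.

Lemma up_right d : awayd d -> up (left (rev d)) = right d.
Proof.
move=> a; have rn : ~~ awayd (rev d) by rewrite awayd_rev a.
have pE : pdir (rev d).1 = (rev d).2 by apply: pdirE; rewrite -surjective_pairing.
have rv : (rev d).1 != v.
  by apply/eqP => e; move: rn; rewrite [rev d]surjective_pairing e awayd_root.
rewrite /up /isroot /= (negbTE rv) /=; case: ifP => [/negP h|_].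
  exfalso; have := @parent_uniq (rev d).1 (rev d).2 ((rev d).2 + 1).
  rewrite -surjective_pairing; move/negP: h => h /(_ rn h) /eqP.
  by rewrite eq_sym I3_add1_neq.
by rewrite pE eqxx -surjective_pairing revK.
Qed.

Definition depth w := size (spath w).

Lemma depth_away d : awayd d -> depth (rev d).1 = (depth d.1).+1.
Proof. by rewrite /awayd /depth rev1 => /eqP ->; rewrite size_rcons. Qed.

(** Each [up] step short of a root corner lowers the depth by one, so [depth] many steps suffice. *)
Definition root c := iter (depth c.1) up c.

Lemma root_id c : isroot c -> root c = c.
Proof. by move=> h; rewrite /root; elim: depth => //= n ->; rewrite /up h. Qed.

(** One [up] step leads from the farther of the two corners to the nearer one, and the farther one
    is iterated exactly once more. *)
Lemma root_left d : root (left d) = root (right (rev d)).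
Proof.
rewrite /root /=; have [a|] := boolP (awayd d).
  by rewrite depth_away // iterSr up_left.
rewrite -awayd_rev => a; have := depth_away a; rewrite revK => ->.
by rewrite iterSr; have := up_right a; rewrite revK => ->.
Qed.

Lemma root_reg c c' : reg c = reg c' -> root c = root c'.
Proof.
move=> /reg_eq; elim=> {c c'} [c c' []|//|//|x y z _ -> _ ->//].
by move=> x w i j xi wj; have := root_left (x, i); rewrite (revE xi wj).
Qed.

(** Root corners thus name regions faithfully, which makes heights unique and the enumeration of
    regions free of repetitions. *)
Lemma reg_inj c c' : isroot c -> isroot c' -> reg c = reg c' -> c = c'.
Proof. by move=> /root_id {2}<- /root_id {2}<- /root_reg. Qed.

Lemma isroot_rev d : awayd d -> isroot (rev d).
Proof. by move=> a; rewrite /isroot awayd_rev a orbT. Qed.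

Lemma isroot_base i : isroot (v, i).
Proof. by rewrite /isroot eqxx. Qed.

Lemma away_rev_neq d : awayd d -> (rev d).1 != v.
Proof.
by move=> a; apply/eqP => e; have := awayd_rev d; rewrite [rev d]surjective_pairing e awayd_root a.
Qed.

(** * Existence and uniqueness of heights *)

Lemma has_height_fun (m : region T) n n' : has_height v m n -> has_height v m n' -> n = n'.
Proof.
move=> h; elim: h n' => {m n} [i|x w i j a b xi wj aw _ IHa _ IHb] n' h.
  move: {1 2}(region_at v i) h (erefl (region_at v i)) => m [] //.
  move=> x w i' j a b xi wj aw _ _ e.
  have a' : awayd (x, i') by apply/awayP; rewrite xi.
  have := reg_inj (isroot_base i) (isroot_rev a').
  rewrite (revE xi wj) => /(_ (esym e)) [vw _].
  by have := away_rev_neq a'; rewrite (revE xi wj) /= vw eqxx.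
have a' : awayd (x, i) by apply/awayP; rewrite xi.
move: {1 2}(region_at w j) h (erefl (region_at w j)) => m [].
  move=> k e; have := reg_inj (isroot_base k) (isroot_rev a').
  rewrite (revE xi wj) => /(_ (e)) [vw _].
  by have := away_rev_neq a'; rewrite (revE xi wj) /= vw eqxx.
move=> x' w' i' j' a2 b2 xi' wj' aw' ha hb e.
have a2' : awayd (x', i') by apply/awayP; rewrite xi'.
(* The root corner of a region determines the edge pointing to it, so both derivations end with the
   same step. *)
have := reg_inj (isroot_rev a2') (isroot_rev a').
rewrite (revE xi wj) (revE xi' wj') => /(_ e) [e1 e2].
have ex : x' = x by rewrite -wj -wj' e1 e2.
have ei : i' = i by apply: (@nbr_inj T x); rewrite xi -ex xi' e1.
by rewrite ex ei in ha hb; rewrite (IHa _ ha) (IHb _ hb).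
Qed.

(** Induction on the depth, with all corners of a vertex at once, since the region ahead of an edge
    depends on two corners at its near end. *)
Lemma corner_ind (Q : corner T -> Prop) :
  (forall i, Q (v, i)) ->
  (forall d, awayd d -> (forall i, Q (d.1, i)) -> forall i, Q ((rev d).1, i)) ->
  forall c, Q c.
Proof.
move=> Q0 QS [w i]; move: {2}(depth w) (erefl (depth w)) i => n.
elim: n w => [|n IH] w dw i.
  have := spathP w; move: dw; rewrite /depth => /size0nil -> /and3P[_ _ /eqP /= <-].
  exact: Q0.
have wv : w != v by apply/eqP => e; move: dw; rewrite e /depth spath_root.
have [j aj] := parent_ex wv.
have a : awayd (rev (w, j)) by rewrite awayd_rev.
have := QS _ a; rewrite revK; apply => k; apply: IH.
by have := depth_away a; rewrite revK /= dw => -[].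
Qed.

Lemma has_height_ex c : exists n, has_height v (reg c) n.
Proof.
elim/corner_ind: c => [i|d a IH i]; first by exists 1%N; constructor.
(* Only the corner opposite to the reversed edge opens a new region; the other two continue the
   sides of [d]. *)
have [->|->|->] := I3_cases (rev d).2 i.
- have [hl hL] := IH (d.2 + 1); have [hr hR] := IH (d.2 - 1).
  exists (hl + hr)%N; apply: (@HeightStep _ v d.1 (rev d).1 d.2) => //; [by rewrite rev1|exact: nbr_rev|].
  by rewrite rev1; apply/awayP; rewrite -surjective_pairing.
- by rewrite -reg_right; exact: IH.
- by rewrite -reg_left; exact: IH.
Qed.

Lemma heightE (m : region T) n : has_height v m n -> height v m = n.
Proof.
move=> h; rewrite /height; case: xgetP => [k -> /= hk|/(_ n)//].
exact: has_height_fun hk h.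
Qed.

Lemma height_base i : height v (reg (v, i)) = 1%N.
Proof. by apply: heightE; constructor. Qed.

Lemma height_step d : awayd d ->
  height v (reg (rev d)) = (height v (reg (left d)) + height v (reg (right d)))%N.
Proof.
move=> a; have [hl hL] := has_height_ex (left d).
have [hr hR] := has_height_ex (right d).
rewrite (heightE hL) (heightE hR); apply: heightE.
apply: (@HeightStep _ v d.1 (rev d).1 d.2) => //; [by rewrite rev1|exact: nbr_rev|].
by rewrite rev1; apply/awayP; rewrite -surjective_pairing.
Qed.

(** * Enumeration of edges and regions by distance from the base vertex *)

Fixpoint level n : seq (corner T) :=
  if n is n'.+1 then map succl (level n') ++ map succr (level n')
  else [seq (v, i) | i <- [:: 0; 1; -1]].

Lemma level_away n d : d \in level n -> awayd d /\ depth d.1 = n.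
Proof.
elim: n d => [|n IH] d.
  by move=> /mapP[i _ ->]; split; [exact: awayd_root|rewrite /depth spath_root].
rewrite mem_cat => /orP[] /mapP[p /IH[a dp] ->]; split; rewrite /= ?depth_away ?dp //;
  apply/negPn/negP => na; have rn : ~~ awayd (rev p) by rewrite awayd_rev a.
  move: (rn); rewrite [rev p]surjective_pairing => /parent_uniq/(_ na)/eqP.
  by rewrite eq_sym I3_add1_neq.
move: (rn); rewrite [rev p]surjective_pairing => /parent_uniq/(_ na)/eqP.
by rewrite eq_sym I3_sub1_neq.
Qed.

Lemma away_level d : awayd d -> d \in level (depth d.1).
Proof.
elim/corner_ind: d => [i _|d a IH i a'].
  rewrite /depth spath_root; apply/mapP; exists i => //.
  by case: i => [[|[|[|]]]].
rewrite depth_away //= mem_cat.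
have dl : d \in level (depth d.1) by have := IH d.2; rewrite -surjective_pairing; apply.
have [e|->|->] := I3_cases (rev d).2 i.
- by move: a'; rewrite e -surjective_pairing awayd_rev a.
- by rewrite (map_f succl dl).
- by rewrite (map_f succr dl) orbT.
Qed.

(** A left successor equal to a right successor would start at a vertex whose unique parent
    direction [j] satisfies [j - 1 = j + 1]. *)
Lemma level_uniq n : uniq (level n).
Proof.
elim: n => [|n IH]; first by rewrite map_inj_uniq // => i j [].
rewrite /= cat_uniq !map_inj_uniq ?IH ?andbT /=; [|exact: succr_inj|exact: succl_inj].
apply/hasPn => _ /mapP[d /level_away[a _] ->]; apply/mapP => -[d' /level_away[a' _] ee].
have e1 : (rev d).1 = (rev d').1 := congr1 fst ee.
have e2 : (rev d).2 - 1 = (rev d').2 + 1 := congr1 snd ee.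
have rn : ~~ awayd (rev d) by rewrite awayd_rev a.
have rn' : ~~ awayd (rev d') by rewrite awayd_rev a'.
move: rn rn'; rewrite [rev d]surjective_pairing [rev d']surjective_pairing.
rewrite -e1 => /parent_uniq h /h e.
by have := I3_sub1_add1 (rev d).2; rewrite e2 e eqxx.
Qed.

(** The regions whose root corner has depth at most [n]. *)
Fixpoint ball n : seq (region T) :=
  if n is k.+1 then ball k ++ [seq reg (rev d) | d <- level k]
  else [seq reg (v, i) | i <- [:: 0; 1; -1]].

Lemma mem_ball n m : m \in ball n ->
  (exists i, m = reg (v, i)) \/ exists d, [/\ awayd d, (depth d.1 < n)%N & m = reg (rev d)].
Proof.
elim: n => [|n IH].
  by case/mapP => i _ ->; left; exists i.
rewrite /= mem_cat => /orP[/IH[|[d [a dn ->]]]|/mapP[d /level_away[a dn] ->]].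
- by left.
- by right; exists d; split => //; apply: ltnW.
- by right; exists d; rewrite dn; split.
Qed.

Lemma ball_uniq n : uniq (ball n).
Proof.
elim: n => [|n IH].
  rewrite map_inj_in_uniq // => i j _ _ /(reg_inj (isroot_base i) (isroot_base j)).
  by case.
rewrite /= cat_uniq IH /= map_inj_in_uniq ?level_uniq ?andbT; last first.
  move=> d d' /level_away[a _] /level_away[a' _] /(reg_inj (isroot_rev a) (isroot_rev a')).
  exact: (can_inj revK).
apply/hasPn => _ /mapP[d /level_away[a dn] ->]; apply/negP => /mem_ball[[i e]|[d' [a' dn' e]]].
  have := away_rev_neq a.
  by rewrite (reg_inj (isroot_rev a) (isroot_base i) e) eqxx.
have := reg_inj (isroot_rev a) (isroot_rev a') e => /(can_inj revK) dd.
by rewrite -dd dn ltnn in dn'.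
Qed.

Lemma ball_sub n k : (n <= k)%N -> {subset ball n <= ball k}.
Proof.
move=> /subnK <-; elim: (k - n)%N => // j IH m /IH.
by rewrite addSn /= mem_cat => ->.
Qed.

Lemma reg_in_ball c : exists n, reg c \in ball n.
Proof.
elim/corner_ind: c => [i|d a IH i].
  exists 0%N; apply/mapP; exists i => //.
  by case: i => [[|[|[|]]]].
have [->|->|->] := I3_cases (rev d).2 i.
- exists (depth d.1).+1; rewrite /= mem_cat; apply/orP; right.
  rewrite -surjective_pairing; apply/mapP; exists d => //; exact: away_level.
- by rewrite -reg_right; exact: IH.
- by rewrite -reg_left; exact: IH.
Qed.

Lemma region_in_ball (m : region T) : exists n, m \in ball n.
Proof.
case: m => A hA; have [c _ cA] := set_mem hA.
have [n hn] := reg_in_ball c; exists n.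
suff -> : exist _ A hA = reg c by [].
by case: c cA {hn} => x i cA; apply: val_inj.
Qed.

Lemma finite_in_ball (s : seq (region T)) : exists n, {subset s <= ball n}.
Proof.
elim: s => [|m s [n IH]]; first by exists 0%N.
have [k hk] := region_in_ball m; exists (maxn n k) => x; rewrite inE => /orP[/eqP->|/IH].
  by apply: ball_sub hk; rewrite leq_maxr.
by apply: ball_sub; rewrite leq_maxl.
Qed.

End Combinatorics.

(** * Triples of real labels *)

Section Triples.
Variable R : realType.
Implicit Types r s t u D : R.

Definition disc r s t : R := r ^+ 2 + s ^+ 2 + t ^+ 2 - r * s * t.

Definition lam (x : R) : R := (x + Num.sqrt (x ^+ 2 - 4)) / 2.

Lemma lamP (x : R) : 2 < x -> 1 < lam x /\ x = lam x + (lam x)^-1.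
Proof.
move=> x2; have h : 0 < x ^+ 2 - 4 by nra.
have q0 : 0 < Num.sqrt (x ^+ 2 - 4) by rewrite sqrtr_gt0.
have qq : Num.sqrt (x ^+ 2 - 4) ^+ 2 = x ^+ 2 - 4 by rewrite sqr_sqrtr // ltW.
rewrite /lam; move: (Num.sqrt _) q0 qq => q q0 qq.
split; first by lra.
suff -> : ((x + q) / 2)^-1 = (x - q) / 2 by field.
apply: (@mulfI _ ((x + q) / 2)); first by apply/lt0r_neq0; lra.
rewrite divff; last by apply/lt0r_neq0; lra.
have -> : (x + q) / 2 * ((x - q) / 2) = (x ^+ 2 - q ^+ 2) / 4 by field.
by rewrite qq; field.
Qed.

(* The coefficient [A] of [x_n = A (lam s)^n + B (lam s)^-n] when [x_0 = t] and [x_1 = u]. *)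
Definition alpha s t u : R := (u - t / lam s) / (lam s - (lam s)^-1).

Definition phi s t u : R := rho t - ln (alpha s t u).

Definition gap_log D (m : R) : R := ln (1 - (D - 4) / (m ^+ 2 - 4)).

(** Shifting the index of x_n by one turns A into A (lam s). *)
Lemma alpha_step s t u : 2 < s -> alpha s u (s * u - t) = lam s * alpha s t u.
Proof.
move=> s2; have [l1 sE] := lamP s2; rewrite /alpha.
move: (lam s) l1 sE => l l1 ->; field.
by apply/andP; split; apply/lt0r_neq0; nra.
Qed.

(** Since x_{-1} = s t - u and reversing the sequence exchanges A and B, the second factor is B;
    likewise in the next two lemmas. *)
Lemma alpha_prod s t u : 2 < s ->
  alpha s t u * alpha s t (s * t - u) = 1 - (disc u s t - 4) / (s ^+ 2 - 4).
Proof.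
move=> s2; have [l1 sE] := lamP s2; rewrite /alpha /disc.
move: (lam s) l1 sE => l l1 ->; field.
have h : 0 < l * l - 1 by nra.
have h2 : 0 < (l * l - 1) ^+ 2 by rewrite exprn_gt0.
by apply/and3P; split; apply/lt0r_neq0; lra.
Qed.

Lemma alpha_add s t u : 2 < s -> alpha s t u + alpha s t (s * t - u) = t.
Proof.
move=> s2; have [l1 sE] := lamP s2; rewrite /alpha.
move: (lam s) l1 sE => l l1 ->; field.
by apply/andP; split; apply/lt0r_neq0; nra.
Qed.

Lemma alpha_sub s t u : 2 < s ->
  alpha s t u - alpha s t (s * t - u) = (2 * u - s * t) / (lam s - (lam s)^-1).
Proof.
move=> s2; have [l1 sE] := lamP s2; rewrite /alpha.
move: (lam s) l1 sE => l l1 ->; field.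
by apply/andP; split; apply/lt0r_neq0; nra.
Qed.

Lemma gap_gt0 D s : 2 < s -> D < 4 -> 0 < - ((D - 4) / (s ^+ 2 - 4)).
Proof. by move=> s2 D4; rewrite -mulNr divr_gt0 //; nra. Qed.

Lemma alpha_gt0 s t u : 2 < s -> 2 < t -> disc u s t < 4 -> 0 < alpha s t u.
Proof.
move=> s2 t2 D4; have := gap_gt0 s2 D4.
have := alpha_prod t u s2; have := alpha_add t u s2; nra.
Qed.

Lemma disc_rot r s t : disc r s t = disc s t r.
Proof. by rewrite /disc; ring. Qed.

Lemma disc_flip r s t : disc (s * t - r) s t = disc r s t.
Proof. by rewrite /disc; ring. Qed.

Lemma phi_step s t u : 2 < s -> 2 < t -> disc u s t < 4 ->
  phi s t u = rho s + rho t - rho u + phi s u (s * u - t).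
Proof.
move=> s2 t2 D4; have a0 := alpha_gt0 s2 t2 D4.
have [l1 _] := lamP s2.
have l0 : 0 < lam s by lra.
rewrite /phi alpha_step // (lnM l0 a0) -[ln (lam s)]/(rho s); ring.
Qed.

(** Around [u] the labels [s], [t] are consecutive. The two weights read the sequence in opposite
    directions: one contains log B, the other log A + rho u, and log A + log B is [gap_log]. *)
Lemma gap_log_corner s t u : 2 < s -> 2 < t -> 2 < u -> disc u s t < 4 ->
  gap_log (disc u s t) u + phi u s (u * s - t) + phi u t (u * t - s) =
  rho s + rho t - rho u.
Proof.
move=> s2 t2 u2 D4.
have D4' : disc t u s < 4 by rewrite disc_rot.
have a0 := alpha_gt0 u2 s2 D4'.
have b0 : 0 < alpha u s (u * s - t) by apply: alpha_gt0 => //; rewrite disc_flip.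
have [l1 _] := lamP u2.
rewrite /gap_log -[disc u s t]disc_rot -alpha_prod // /phi (alpha_step s t u2).
have l0 : 0 < lam u by lra.
rewrite (lnM a0 b0) (lnM l0 a0) -[ln (lam u)]/(rho u); ring.
Qed.

(** With l = lam t, A + B = l + 1/l gives (l - A)(A - 1/l) = AB - 1 > 0. *)
Lemma alpha_bounds s t u : 2 < s -> 2 < t -> disc u s t < 4 ->
  (lam t)^-1 <= alpha s t u <= lam t.
Proof.
move=> s2 t2 D4; have := gap_gt0 s2 D4.
have [l1 tE] := lamP t2.
have := alpha_prod t u s2; have := alpha_add t u s2.
have li : lam t * (lam t)^-1 = 1 by rewrite divff //; apply/lt0r_neq0; lra.
move: (lam t) (lam t)^-1 l1 tE li (alpha s t u) (alpha s t (s * t - u)) => l l' l1 tE li a b ab.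
have -> : b = l + l' - a by lra.
move=> p g; have {p} : 0 < (l - a) * (a - l') by nra.
have l'1 : l' < 1 by nra.
by move=> q; apply/andP; split; rewrite leNgt; apply/negP => c; nra.
Qed.

Lemma phi_ge0 s t u : 2 < s -> 2 < t -> disc u s t < 4 -> 0 <= phi s t u.
Proof.
move=> s2 t2 D4; have /andP[_ h] := alpha_bounds s2 t2 D4.
have a0 := alpha_gt0 s2 t2 D4.
by rewrite subr_ge0 ler_ln // posrE; apply: lt_le_trans h.
Qed.

(** Going uphill means A >= B. Then ln (l / A) <= (l - A) / A, and (l - A)(A - 1/l) = K / (s^2 -
    4). *)
Lemma phi_le s t u : 2 < s -> 2 < t -> disc u s t < 4 -> s * t <= 2 * u ->
  phi s t u <= 4 * (4 - disc u s t) / ((s ^+ 2 - 4) * (t ^+ 2 - 4)).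
Proof.
move=> s2 t2 D4 up; have /andP[h' h] := alpha_bounds s2 t2 D4.
have a0 := alpha_gt0 s2 t2 D4.
have [l1 tE] := lamP t2; have [ls1 _] := lamP s2.
have ab : alpha s t (s * t - u) <= alpha s t u.
  rewrite -subr_ge0 alpha_sub // divr_ge0 //; first lra.
  by rewrite subr_ge0 ltW // (lt_trans _ ls1) // invf_lt1 //; lra.
have := alpha_prod t u s2; have := alpha_add t u s2.
have -> : phi s t u = ln (lam t / alpha s t u).
  by rewrite /phi lnM ?lnV ?posrE ?invr_gt0 //; lra.
have l0 : 0 < lam t by lra.
have li : lam t * (lam t)^-1 = 1 by rewrite divff // lt0r_neq0.
move: (lam t) (lam t)^-1 li l1 tE l0 h h' ab a0 => l l' li l1 tE l0 h h' ab a0.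
set a := alpha s t u in h h' ab a0 *; move: (alpha s t (s * t - u)) ab => b ab sab pab.
have x1 : -1 < l / a - 1 by rewrite ltrDr divr_gt0.
have := le_ln1Dx x1; rewrite [1 + _]addrC subrK => /le_trans; apply.
set K := 4 - _; have K0 : 0 < K by rewrite /K; lra.
have s4 : 0 < s ^+ 2 - 4 by nra.
have t4 : 0 < t ^+ 2 - 4 by nra.
have kE : (l - a) * (a - l') = K / (s ^+ 2 - 4).
  have : (disc u s t - 4) / (s ^+ 2 - 4) = - (K / (s ^+ 2 - 4)) by rewrite -mulNr /K opprB.
  by move: pab => /[swap] ->; nra.
have l'0 : 0 < l' by nra.
have l'1 : l' < 1 by nra.
(* From 2 a >= t = l + l', both 2 a and 2 (a - l') are at least l - l', whose square is t^2 - 4. *)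
have big : t ^+ 2 - 4 <= 4 * (a * (a - l')).
  have -> : t ^+ 2 - 4 = (l - l') * (l - l') by nra.
  have -> : 4 * (a * (a - l')) = (2 * a) * (2 * (a - l')) by ring.
  by apply: ler_pM; lra.
have -> : l / a - 1 = (l - a) / a by field; apply/lt0r_neq0.
rewrite ler_pdivrMr // mulrAC ler_pdivlMr ?mulr_gt0 //.
have {}kE : (l - a) * (a - l') * (s ^+ 2 - 4) = K.
  by rewrite kE divfK // lt0r_neq0.
have la : 0 <= (l - a) * (s ^+ 2 - 4) by apply: mulr_ge0; lra.
by have := ler_wpM2l la big; rewrite -kE; lra.
Qed.

Lemma ln_ge (x : R) : 0 < x -> x / (1 + x) <= ln (1 + x).
Proof.
move=> x0; have h : -1 < (1 + x)^-1 - 1 by rewrite ltrDr invr_gt0; lra.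
have := le_ln1Dx h; rewrite [1 + (_ - _)]addrC subrK lnV ?posrE; last by lra.
have -> : x / (1 + x) = 1 - (1 + x)^-1 by field; apply/lt0r_neq0; lra.
lra.
Qed.

Lemma gap_log_gt0 D m : 2 < m -> D < 4 -> 0 < gap_log D m.
Proof. by move=> m2 D4; have := gap_gt0 m2 D4; rewrite /gap_log => h; apply: ln_gt0; lra. Qed.

Lemma gap_log_ge D m : 2 < m -> D < 4 -> (4 - D) / (m ^+ 2 - D) <= gap_log D m.
Proof.
move=> m2 D4; have g := gap_gt0 m2 D4.
have := ln_ge g; rewrite /gap_log; congr (_ <= _).
by field; apply/andP; split; apply/lt0r_neq0; nra.
Qed.

Lemma phi_le_gap_log (mu : R) : 2 < mu -> exists2 C : R, 0 < C &
  forall s t u, mu <= s -> mu <= t -> 2 < u -> s * t <= 2 * u -> u <= s * t ->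
  disc u s t < 4 ->
  phi s t u <= C * gap_log (disc u s t) u.
Proof.
move=> mu2; pose d := mu ^+ 2 - 4; have d0 : 0 < d by rewrite /d; nra.
(* Chosen so that u^2 - D <= c a b for a = s^2 - 4 and b = t^2 - 4: here u^2 <= (a + 4)(b + 4), K <=
   a b / 4, and a, b >= d. This compares [phi_le] with [gap_log_ge]. *)
pose c := 5 / 4 + 8 / d + 16 / d ^+ 2.
have c0 : 0 < c by rewrite /c !addr_gt0 ?divr_gt0 ?exprn_gt0.
exists (4 * c) => [|s t u mus mut u2 up us D4]; first by lra.
have s2 : 2 < s by lra.
have t2 : 2 < t by lra.
apply: le_trans (phi_le s2 t2 D4 up) _.
have := gap_log_ge u2 D4; set K := 4 - disc u s t => g.
rewrite -!mulrA ler_pM2l; last by lra.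
have K0 : 0 < K by rewrite /K; lra.
have da : d <= s ^+ 2 - 4 by rewrite /d; nra.
have db : d <= t ^+ 2 - 4 by rewrite /d; nra.
have uK : u ^+ 2 - disc u s t = u ^+ 2 - 4 + K by rewrite /K; ring.
have dq : (2 * u - s * t) ^+ 2 = (s ^+ 2 - 4) * (t ^+ 2 - 4) - 4 * K by rewrite /K /disc; ring.
have ust : u ^+ 2 <= (s ^+ 2 - 4 + 4) * (t ^+ 2 - 4 + 4) by nra.
rewrite uK in g; move: (s ^+ 2 - 4) (t ^+ 2 - 4) da db dq ust => a b da db dq ust.
have ab0 : 0 < a * b by rewrite mulr_gt0; lra.
have aE : a <= a * b / d by rewrite ler_pdivlMr // ler_wpM2l; lra.
have bE : b <= a * b / d by rewrite ler_pdivlMr // [a * b]mulrC ler_wpM2l; lra.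
have dE : 1 <= a * b / d ^+ 2 by rewrite ler_pdivlMr ?exprn_gt0 // mul1r expr2; apply: ler_pM; lra.
have Kab : 4 * K <= a * b by have := sqr_ge0 (2 * u - s * t); lra.
have key : u ^+ 2 - 4 + K <= c * (a * b).
  have -> : c * (a * b) = 5 / 4 * (a * b) + 8 * (a * b / d) + 16 * (a * b / d ^+ 2).
    by rewrite /c; ring.
  lra.
have uu : 0 < u ^+ 2 - 4 + K by nra.
apply: le_trans (_ : c * (K / (u ^+ 2 - 4 + K)) <= _); last by rewrite ler_pM2l.
rewrite mulrCA ler_pM2l // ler_pdivlMr // mulrC ler_pdivrMr //.
Qed.

(** * Inequalities for descents and sinks *)

(** For two consecutive descents, the first lowering the label sum S by e = 2 r - s t, one has e^2 =
    (s^2 - 4)(t^2 - 4) + 4 (D - 4). If D >= 4, bound e^2 by e S^2; otherwise bound the product by e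
    S^2. *)
Lemma descent_gap r s t : 2 < s -> 2 < t -> 2 < s * t - r ->
  s * t < 2 * r -> s * (s * t - r) < 2 * t ->
  4 * `|disc r s t - 4| <= (2 * r - s * t) * (r + s + t) ^+ 2.
Proof.
move=> s2 t2 u2 d1 d2; set D := disc r s t.
have sq : (2 * r - s * t) ^+ 2 = (s ^+ 2 - 4) * (t ^+ 2 - 4) + 4 * (D - 4).
  by rewrite /D /disc; ring.
(* With u = s t - r, the second descent s u < 2 t gives 2 e > u (s^2 - 4), and u > 2. *)
have s1 : s ^+ 2 - 4 <= 2 * r - s * t.
  have : (s * t - r) * (s ^+ 2 - 4) <= 2 * (2 * r - s * t) by nra.
  have : 0 < (s * t - r - 2) * (s ^+ 2 - 4) by apply: mulr_gt0; nra.
  nra.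
have r2 : 2 < r by nra.
set e := 2 * r - s * t in sq s1 *; have e0 : 0 < e by rewrite /e; lra.
have eS : e <= r by rewrite /e; lra.
have S1 : t ^+ 2 <= (r + s + t) ^+ 2 by nra.
have S2 : r <= (r + s + t) ^+ 2 by nra.
have st0 : 0 <= (s ^+ 2 - 4) * (t ^+ 2 - 4) by apply: mulr_ge0; nra.
have [D4|D4] := leP 4 D.
  rewrite ger0_norm; last by lra.
  apply: le_trans (_ : e ^+ 2 <= _); first by lra.
  by rewrite expr2 ler_pM2l //; lra.
rewrite ltr0_norm; last by lra.
have : (s ^+ 2 - 4) * (t ^+ 2 - 4) <= e * (r + s + t) ^+ 2.
  by apply: ler_pM => //; nra.
by have := sqr_ge0 e; lra.
Qed.

(** Here 0 <= s t - 2 r <= s (t - 2), and (s^2 - 4)(t^2 - 4) exceeds s^2 (t - 2)^2 by 4 (t - 2)(s^2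
    - t - 2) > 0. *)
Lemma sink_disc_aux r s t : 2 < t -> t <= s -> s <= r -> 2 * r <= s * t -> disc r s t < 4.
Proof.
move=> t2 ts sr h.
have sq : (s * t - 2 * r) ^+ 2 = (s ^+ 2 - 4) * (t ^+ 2 - 4) + 4 * (disc r s t - 4).
  by rewrite /disc; ring.
have : (s * t - 2 * r) ^+ 2 <= (s * (t - 2)) ^+ 2 by rewrite ler_sqr ?nnegrE; nra.
have : 0 < (t - 2) * (s ^+ 2 - t - 2) by apply: mulr_gt0; nra.
by rewrite sq => h1 h2; nra.
Qed.

Lemma sink_disc r s t : 2 < r -> 2 < s -> 2 < t ->
  2 * r <= s * t -> 2 * s <= r * t -> 2 * t <= r * s -> disc r s t < 4.
Proof.
move=> r2 s2 t2 hr hs ht.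
have [rs|/ltW rs] := leP s r; have [st|/ltW st] := leP t s; have [tr|/ltW tr] := leP r t.
- by apply: sink_disc_aux => //; lra.
- exact: sink_disc_aux.
- have -> : disc r s t = disc t r s by rewrite /disc; ring.
  by apply: sink_disc_aux => //; lra.
- have -> : disc r s t = disc r t s by rewrite /disc; ring.
  by apply: sink_disc_aux => //; lra.
- have -> : disc r s t = disc s t r by rewrite /disc; ring.
  by apply: sink_disc_aux => //; lra.
- have -> : disc r s t = disc s r t by rewrite /disc; ring.
  by apply: sink_disc_aux => //; lra.
- have -> : disc r s t = disc t s r by rewrite /disc; ring.
  by apply: sink_disc_aux => //; lra.
- by apply: sink_disc_aux => //; lra.
Qed.

End Triples.

(** * Summation over the regions *)

Lemma no_linear_descent (R : realType) (f : nat -> R) (e : R) : 0 < e ->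
  (forall n, 0 <= f n) -> (forall n, f n.+1 <= f n - e) -> False.
Proof.
move=> e0 f0 fS; have h n : f n <= f 0%N - n%:R * e.
  elim: n => [|n IH]; first by rewrite mul0r subr0.
  by rewrite -natr1 mulrDl mul1r; have := fS n; lra.
have [n hn] : exists n, f 0%N / e < n%:R.
  by exists (Num.bound (f 0%N / e)); apply: archi_boundP; rewrite divr_ge0 // ltW.
by rewrite ltr_pdivrMr // in hn; have := h n; have := f0 n; lra.
Qed.

Lemma ler_sum_subset (R : numDomainType) (I : eqType) (s s' : seq I) (F : I -> R) :
  uniq s -> uniq s' -> {subset s <= s'} -> (forall i, 0 <= F i) ->
  \sum_(i <- s) F i <= \sum_(i <- s') F i.
Proof.
move=> us us' ss F0.
have sE : perm_eq [seq i <- s' | i \in s] s.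
  apply: uniq_perm => [|//|i]; first exact: filter_uniq.
  by rewrite mem_filter; case: (boolP (i \in s)) => // /ss.
rewrite [leRHS](bigID (mem s)) /= -[X in X + _]big_filter (perm_big _ sE) /=.
by rewrite lerDl sumr_ge0.
Qed.

(** A finite set containing [B n] lies in some [B k], so its sum is squeezed between the sum over
    [B n] and [l]. *)
Lemma has_sum_exhaustion (I : choiceType) (R : realType) (x : I -> R) (l : R)
    (B : nat -> seq I) :
  (forall i, 0 <= x i) -> (forall n, uniq (B n)) ->
  (forall s : seq I, exists n, {subset s <= B n}) ->
  (forall n, \sum_(i <- B n) x i <= l) ->
  (forall e, 0 < e -> exists n, l - e < \sum_(i <- B n) x i) ->
  has_sum x l.
Proof.
move=> x0 uB exB leB geB; have FF := @summability.totally_filter I.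
apply/cvgrPdist_lt => e e0.
have [n hn] := geB e e0.
exists [fset i in B n]%fset => // A /fsubsetP AB.
have xA : summability.partial_sum x A = \sum_(i <- A) x i by rewrite big_seq_fsetE.
have [k hk] := exB A.
have le1 : \sum_(i <- B n) x i <= \sum_(i <- A) x i.
  by apply: ler_sum_subset => // i iB; apply: AB; rewrite inE.
have le2 : \sum_(i <- A) x i <= \sum_(i <- B k) x i by apply: ler_sum_subset.
rewrite /= xA ger0_norm; first by lra.
by have := leB k; lra.
Qed.

(** * Labels and discriminator along the tree *)

Section Topograph.
Variables (R : realType) (G : real_markov_topograph R) (D : R).
Hypothesis hlabel : forall m : region G, 2 < label m.
Hypothesis hD : is_discriminator G D.
Hypothesis hD4 : D <> 4.
Implicit Types (c d : corner G).

(** For an edge [d], this is the label behind it, and [lab (rev d)] the one ahead. *)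
Definition lab c : R := label (reg c).

Lemma lab_gt2 c : 2 < lab c. Proof. exact: hlabel. Qed.

Lemma lab_rev d : lab (rev d) = lab (left d) * lab (right d) - lab d.
Proof.
have := @label_edge _ G d.1 (rev d).1 d.2 (rev d).2; rewrite rev1 -rev1 nbr_rev.
by move=> /(_ erefl erefl) <-; rewrite [X in X - _]addrC addrK.
Qed.

Lemma lab_left_succl d : lab (left (succl d)) = lab (left d).
Proof. by rewrite /lab reg_left_succl. Qed.

Lemma lab_right_succr d : lab (right (succr d)) = lab (right d).
Proof. by rewrite /lab reg_right_succr. Qed.

Lemma lab_right_succl d : lab (right (succl d)) = lab (rev d).
Proof. by rewrite right_left. Qed.

Lemma lab_left_succr d : lab (left (succr d)) = lab (rev d).
Proof. by rewrite left_right. Qed.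

Lemma lab_succl d : lab (succl d) = lab (right d).
Proof. by rewrite /lab reg_right. Qed.

Lemma lab_succr d : lab (succr d) = lab (left d).
Proof. by rewrite /lab reg_left. Qed.

Definition corner_disc c := disc (lab c) (lab (left c)) (lab (right c)).

Lemma corner_disc_left c : corner_disc (left c) = corner_disc c.
Proof. by rewrite /corner_disc left_left right_left -disc_rot. Qed.

Lemma corner_disc_vertex w i j : corner_disc (w, i) = corner_disc (w, j).
Proof.
have [->|->|->] // := I3_cases i j.
  by rewrite -[RHS]/(corner_disc (left (w, i))) corner_disc_left.
by rewrite -[RHS]corner_disc_left -[RHS]/(corner_disc (left (right (w, i)))) left_right.
Qed.

Lemma corner_disc_rev d : corner_disc (rev d) = corner_disc d.
Proof.
rewrite /corner_disc lab_rev -[left (rev d)]/(succl d) -[right (rev d)]/(succr d).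
by rewrite lab_succl lab_succr /disc; ring.
Qed.

Lemma corner_discE c : corner_disc c = D.
Proof.
have [v [r [s [t [[i [-> -> ->]] ->]]]]] := hD.
rewrite -[RHS]/(corner_disc (v, i)); move: c; apply: (@corner_ind _ v) => [j|d _ IH j].
  exact: corner_disc_vertex.
rewrite (corner_disc_vertex _ _ (rev d).2) -surjective_pairing corner_disc_rev.
by have := IH d.2; rewrite -surjective_pairing.
Qed.

Lemma disc_edge d : disc (lab (rev d)) (lab (left d)) (lab (right d)) = D.
Proof. by rewrite lab_rev disc_flip -[LHS]/(corner_disc d) corner_discE. Qed.

(* By [lab_rev], the label ahead of [d] is smaller than the one behind. *)
Definition descending d := lab (left d) * lab (right d) < 2 * lab d.

(** From s t < 2 r and r t < 2 s follows t^2 < 4; so at most one edge descends from a vertex. *)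
Lemma descending_left c : descending c -> ~~ descending (left c).
Proof.
rewrite /descending left_left right_left -leNgt.
have := (lab_gt2 c, lab_gt2 (left c), lab_gt2 (right c)) => -[[c2 l2] r2] h.
have : 4 * lab c < lab (right c) * lab (right c) * lab c by rewrite ltr_pM2r; nra.
nra.
Qed.

Lemma descending_right c : descending c -> ~~ descending (right c).
Proof. by apply: contraL => /descending_left; rewrite left_right. Qed.

Lemma descending_uniq w i j : descending (w, i) -> descending (w, j) -> i = j.
Proof.
have [->|->|->] // := I3_cases i j.
- by move=> /descending_left/negP h /h.
- by move=> /descending_right/negP h /h.
Qed.

(** If [d] does not descend, the label ahead is at least half the product of the sides, which keeps
    the next edge from descending. *)
Lemma descending_succl d : descending (succl d) -> descending d.
Proof.
rewrite /descending lab_left_succl lab_right_succl lab_succl lab_rev.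
by have := (lab_gt2 d, lab_gt2 (left d), lab_gt2 (right d)) => -[[c2 l2] r2]; nra.
Qed.

Lemma descending_succr d : descending (succr d) -> descending d.
Proof.
rewrite /descending lab_left_succr lab_right_succr lab_succr lab_rev.
by have := (lab_gt2 d, lab_gt2 (left d), lab_gt2 (right d)) => -[[c2 l2] r2]; nra.
Qed.

Lemma descending_rev d : descending d -> ~~ descending (rev d).
Proof.
rewrite /descending -[left (rev d)]/(succl d) -[right (rev d)]/(succr d).
by rewrite lab_succl lab_succr lab_rev -leNgt; lra.
Qed.

(** * Descent to a sink *)

Lemma sink_lt4 c : ~~ descending c -> ~~ descending (left c) -> ~~ descending (right c) ->
  D < 4.
Proof.
rewrite /descending left_left right_right left_right right_left -!leNgt => h1 h2 h3.
rewrite -(corner_discE c); apply: sink_disc; rewrite ?lab_gt2 //.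
by rewrite [lab c * _]mulrC.
Qed.

(** When neither following edge descends, the value is not descending, which signals the end of the
    descent. *)
Definition descend d := if descending (succl d) then succl d else succr d.

Definition perimeter c := lab c + lab (left c) + lab (right c).

Lemma perimeter_succl d :
  perimeter (succl d) = perimeter d - (2 * lab d - lab (left d) * lab (right d)).
Proof.
by rewrite /perimeter lab_succl lab_left_succl lab_right_succl lab_rev; ring.
Qed.

Lemma perimeter_succr d :
  perimeter (succr d) = perimeter d - (2 * lab d - lab (left d) * lab (right d)).
Proof.
by rewrite /perimeter lab_succr lab_left_succr lab_right_succr lab_rev; ring.
Qed.

Lemma perimeter_descend d : descending d -> descending (descend d) ->
  perimeter (descend d) <= perimeter d - 4 * `|D - 4| / perimeter d ^+ 2.
Proof.
have := (lab_gt2 d, lab_gt2 (left d), lab_gt2 (right d)) => -[[c2 l2] r2] hd hd'.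
have p0 : 0 < perimeter d ^+ 2 by rewrite exprn_gt0 // /perimeter; lra.
have -> : perimeter (descend d) = perimeter d - (2 * lab d - lab (left d) * lab (right d)).
  by rewrite /descend; case: ifP => _; rewrite ?perimeter_succl ?perimeter_succr.
rewrite lerD2l lerN2 ler_pdivrMr // -(corner_discE d).
have u2 := lab_gt2 (rev d); rewrite lab_rev in u2.
move: hd'; rewrite /descend; case: ifP => _.
  rewrite /descending lab_left_succl lab_right_succl lab_succl lab_rev.
  exact: descent_gap.
rewrite /descending lab_left_succr lab_right_succr lab_succr lab_rev => h.
rewrite /corner_disc /perimeter.
have -> : disc (lab d) (lab (left d)) (lab (right d)) =
          disc (lab d) (lab (right d)) (lab (left d)).
  by rewrite /disc; ring.
rewrite [lab d + _ + _]addrAC [lab (left d) * lab (right d)]mulrC.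
apply: descent_gap => //; rewrite [lab (right d) * lab (left d)]mulrC //.
by rewrite [lab (right d) * _]mulrC.
Qed.

Lemma descent_stops d : exists n, ~~ descending (iter n descend d).
Proof.
apply/not_existsP => /= h.
have {}h n : descending (iter n descend d) by apply/negPn/negP/h.
pose f n := perimeter (iter n descend d).
have f0 n : 0 < f n.
  rewrite /f /perimeter; move: (iter n descend d) => c.
  by have := (lab_gt2 c, lab_gt2 (left c), lab_gt2 (right c)) => -[[? ?] ?]; lra.
have D0 : 0 < 4 * `|D - 4| by rewrite mulr_gt0 // normr_gt0 subr_eq0; apply/eqP.
have fS n : f n.+1 <= f n - 4 * `|D - 4| / f n ^+ 2.
  by apply: perimeter_descend; [exact: h|exact: (h n.+1)].
have fd n : f n <= f 0%N.
  elim: n => // n; apply: le_trans; apply: le_trans (fS n) _.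
  by rewrite gerBl divr_ge0 ?sqr_ge0 // ltW.
(* The perimeter never exceeds its initial value, so every step loses at least this fixed amount,
   positive because D differs from 4. *)
apply: (@no_linear_descent _ f (4 * `|D - 4| / f 0%N ^+ 2)).
- by rewrite divr_gt0 // exprn_gt0.
- by move=> n; apply/ltW.
- move=> n; apply: le_trans (fS n) _.
  rewrite lerD2l lerN2 ler_pM2l // lef_pV2 ?posrE ?exprn_gt0 //.
  by rewrite ler_sqr ?fd ?nnegrE //; apply/ltW.
Qed.

(** The far end of the last edge of a descent is a sink; if no edge descends from [v], then [v] is
    one. *)
Lemma discriminator_lt4 : D < 4.
Proof.
have [v _] := hD.
have key d : descending d -> D < 4.
  have [n] := descent_stops d; elim: n d => [|n IH] d hn dd; first by rewrite /= dd in hn.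
  have [h|h] := boolP (descending (descend d)); first by apply: IH h; rewrite -iterSr.
  have [hl hr] : ~~ descending (succl d) /\ ~~ descending (succr d).
    move: h; rewrite /descend; case: ifP => [->//|/negbT hl hr]; by [].
  exact: sink_lt4 (descending_rev dd) hl hr.
have [/key//|h0] := boolP (descending (v, 0)).
have [/key//|h1] := boolP (descending (left (v, 0))).
have [/key//|h2] := boolP (descending (right (v, 0))).
exact: sink_lt4 h0 h1 h2.
Qed.

(** * Ascent far from the base vertex *)

Variable v : vertex G.

(** A descending edge has a descending predecessor and no descending sibling, so those leading away
    from [v] form a single descent, starting with [d0]. *)
Lemma level_ascending_ex : exists N, forall d, d \in level v N -> ~~ descending d.
Proof.
pose d0 : corner G := (v, odflt 0 [pick i | descending (v, i)]).
have key n d : d \in level v n -> descending d -> d = iter n descend d0.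
  elim: n d => [|n IH] d.
    move=> /mapP[i _ ->]; rewrite /d0; case: pickP => [j h h'|/(_ i) -> //] /=.
    by rewrite (descending_uniq h h').
  rewrite /= mem_cat => /orP[] /mapP[p pn ->] h.
    by rewrite -(IH p) //; [rewrite /descend h|exact: descending_succl].
  rewrite -(IH p) //; last exact: descending_succr.
  rewrite /descend ifN //; apply: contraL h => /descending_left.
  by rewrite /succl left_left.
have [N hN] := descent_stops d0; exists N => d dN; apply/negP => h.
by rewrite -(key _ _ dN h) h in hN.
Qed.

Lemma sides_bound (s : seq (corner G)) : exists2 mu : R, 2 < mu &
  {in s, forall d, mu <= lab (left d) /\ mu <= lab (right d)}.
Proof.
elim: s => [|d s [mu mu2 IH]]; first by exists 3; [lra|].
exists (Num.min mu (Num.min (lab (left d)) (lab (right d)))).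
  by rewrite !lt_min mu2 !lab_gt2.
move=> e; rewrite inE => /orP[/eqP->|/IH[h1 h2]]; rewrite !ge_min ?h1 ?h2 ?lexx ?orbT //.
Qed.

(** The bound [mu] at level [N] persists: uphill, the label ahead is at least half the product of
    the sides, hence at least either side. *)
Lemma level_ascending : exists N, exists2 mu : R, 2 < mu &
  forall n d, (N <= n)%N -> d \in level v n ->
  [/\ ~~ descending d, mu <= lab (left d) & mu <= lab (right d)].
Proof.
have [N hN] := level_ascending_ex; have [mu mu2 hmu] := sides_bound (level v N).
exists N, mu => // n d /subnK <-; elim: (n - N)%N d => [|k IH] d.
  by move=> h; have [? ?] := hmu d h; split => //; apply: hN.
have up p : p \in level v (k + N) -> mu <= lab (rev p).
  move=> /IH[hp hl hr]; rewrite /descending -leNgt in hp.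
  have := lab_gt2 (right p); have := lab_gt2 (left p).
  by rewrite lab_rev => l2 r2; nra.
rewrite addSn /= mem_cat => /orP[] /mapP[p pn ->]; have [hp hl hr] := IH p pn; split.
- by apply: contra hp; exact: descending_succl.
- by rewrite lab_left_succl.
- by rewrite lab_right_succl; exact: up.
- by apply: contra hp; exact: descending_succr.
- by rewrite lab_left_succr; exact: up.
- by rewrite lab_right_succr.
Qed.

(** * Telescoping over the levels *)

Notation ht c := ((height v (reg c))%:R : R).

Definition term (m : region G) : R :=
  (height v m)%:R * gap_log D (label m).

(* Turns out to be the sum of [term] over the regions lying beyond the edge [d]. *)
Definition branch d : R :=
  ht (left d) * phi (lab (left d)) (lab (right d)) (lab (rev d)) +
  ht (right d) * phi (lab (right d)) (lab (left d)) (lab (rev d)).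

Lemma disc_edgeC d : disc (lab (rev d)) (lab (right d)) (lab (left d)) = D.
Proof. by rewrite -(disc_edge d) /disc; ring. Qed.

Lemma term_ge0 m : 0 <= term m.
Proof. by rewrite mulr_ge0 // ltW // gap_log_gt0 // discriminator_lt4. Qed.

Lemma branch_ge0 d : 0 <= branch d.
Proof.
have D4 := discriminator_lt4.
by rewrite addr_ge0 // mulr_ge0 // phi_ge0 ?lab_gt2 ?disc_edge ?disc_edgeC.
Qed.

(** By [phi_step] both weights of [d] leave the excess rho s + rho t - rho u, multiplied in total by
    h_s + h_t, the height of u; [gap_log_corner] turns it into the term of u and the remaining
    weights. *)
Lemma branch_step d : awayd v d ->
  branch d = term (reg (rev d)) + branch (succl d) + branch (succr d).
Proof.
move=> a; have D4 := discriminator_lt4.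
rewrite /branch /term -[label (reg (rev d))]/(lab (rev d)).
rewrite (lab_rev (succl d)) (lab_rev (succr d)) reg_left_succl reg_right_succr.
rewrite !(lab_left_succl, lab_right_succl, lab_succl).
rewrite !(lab_left_succr, lab_right_succr, lab_succr).
rewrite right_left left_right (height_step a) natrD.
have := disc_edge d; have := disc_edgeC d.
have := (lab_gt2 (rev d), lab_gt2 (left d), lab_gt2 (right d)) => -[[]].
move: (lab (rev d)) (lab (left d)) (lab (right d)) (ht (left d)) (ht (right d)).
move=> u s t hs htt u2 s2 t2 e1 e2.
have c := gap_log_corner s2 t2 u2; rewrite e2 in c; move/(_ D4) in c.
have p1 := @phi_step R s t u s2 t2; rewrite e2 in p1; move/(_ D4) in p1.
have p2 := @phi_step R t s u t2 s2; rewrite e1 in p2; move/(_ D4) in p2.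
rewrite p1 p2 [rho t + rho s]addrC -c [t * u]mulrC [u * s]mulrC; ring.
Qed.

(** All heights are 1, and the identity is the sum of [gap_log_corner] over the three corners at
    [v]. *)
Lemma branch_root i (c := (v, i) : corner G) :
  term (reg c) + term (reg (left c)) + term (reg (right c)) +
  (branch c + branch (left c) + branch (right c)) =
  rho (lab c) + rho (lab (left c)) + rho (lab (right c)).
Proof.
have D4 := discriminator_lt4.
have cD := corner_discE c; rewrite /corner_disc in cD.
rewrite /branch /term -![label (reg _)]/(lab _) !lab_rev.
rewrite !(left_left, right_right, left_right, right_left).
rewrite !height_base !mul1r.
have := (lab_gt2 c, lab_gt2 (left c), lab_gt2 (right c)) => -[[]].
move: (lab c) (lab (left c)) (lab (right c)) cD => r s t cD r2 s2 t2.
have D1 : disc r s t < 4 by rewrite cD.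
have D2 : disc s t r < 4 by rewrite -disc_rot.
have D3 : disc t r s < 4 by rewrite disc_rot.
have := gap_log_corner s2 t2 r2 D1.
have := gap_log_corner t2 r2 s2 D2.
have := gap_log_corner r2 s2 t2 D3.
rewrite -[disc s t r]disc_rot [disc t r s]disc_rot !cD.
rewrite [s * r]mulrC [t * s]mulrC [t * r]mulrC; lra.
Qed.

Definition remainder n : R := \sum_(d <- level v n) branch d.

Lemma remainder_step n :
  remainder n = \sum_(d <- level v n) term (reg (rev d)) + remainder n.+1.
Proof.
rewrite /remainder /= big_cat !big_map /= -!big_split /=; apply: eq_big_seq => d /level_away[a _].
by rewrite branch_step // addrA.
Qed.

Lemma ball_sum n : \sum_(m <- ball v n) term m + remainder n =
  rho (lab (v, 0)) + rho (lab (left (v, 0))) + rho (lab (right (v, 0))).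
Proof.
elim: n => [|n <-]; last by rewrite /= big_cat big_map /= -addrA -remainder_step.
rewrite -branch_root /left /right /= add0r sub0r /remainder /=.
by rewrite !big_cons !big_nil !addr0 !addrA.
Qed.

Lemma remainder_ge0 n : 0 <= remainder n.
Proof. by apply: sumr_ge0 => d _; apply: branch_ge0. Qed.

Lemma remainder_small (e : R) : 0 < e -> exists n, remainder n < e.
Proof.
move=> e0; have [N [mu mu2 hN]] := level_ascending.
have D4 := discriminator_lt4; have [C C0 hC] := phi_le_gap_log mu2.
have le_term n d : (N <= n)%N -> d \in level v n -> branch d <= C * term (reg (rev d)).
  move=> Nn dn; have [dd hl hr] := hN n d Nn dn; have [a _] := level_away dn.
  rewrite /descending -leNgt in dd.
  rewrite /branch /term (height_step a) natrD -[label _]/(lab (rev d)) mulrDl mulrDr.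
  have uE : lab (rev d) + lab d = lab (left d) * lab (right d) by rewrite lab_rev subrK.
  have u2 := lab_gt2 (rev d); have r2 := lab_gt2 d.
  apply: lerD; rewrite mulrCA ler_wpM2l //.
    by rewrite -(disc_edge d); apply: hC; rewrite ?disc_edge //; lra.
  by rewrite -(disc_edgeC d); apply: hC; rewrite ?disc_edgeC //; lra.
have le_rem n : (N <= n)%N -> remainder n <= C * (remainder n - remainder n.+1).
  move=> Nn; rewrite [X in X - _]remainder_step addrK mulr_sumr /remainder.
  by rewrite big_seq [leRHS]big_seq; apply: ler_sum => d; apply: le_term.
apply/not_existsP => /= h.
(* If the remainders stayed at least [e], each step beyond [N] would lower them by at least
   [e / C]. *)
apply: (@no_linear_descent _ (fun k => remainder (k + N)) (e / C)).
- exact: divr_gt0.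
- by move=> k; apply: remainder_ge0.
- move=> k; have /negP := h (k + N)%N; rewrite -leNgt => ek.
  have := le_trans ek (le_rem _ (leq_addl k N)).
  by rewrite mulrC -ler_pdivrMr // addSn; lra.
Qed.

Lemma has_sum_term : has_sum term
  (rho (lab (v, 0)) + rho (lab (left (v, 0))) + rho (lab (right (v, 0)))).
Proof.
apply: (@has_sum_exhaustion _ _ _ _ (ball v)).
- exact: term_ge0.
- exact: ball_uniq.
- exact: finite_in_ball.
- by move=> n; rewrite -(ball_sum n) lerDl remainder_ge0.
- move=> e /remainder_small[n hn]; exists n; have := ball_sum n; lra.
Qed.

End Topograph.

Theorem theorem9p13 (R : realType) (G : real_markov_topograph R) (D : R)
    (hlabel : forall m : region G, 2 < label m)
    (hD : is_discriminator G D) (hD4 : D <> 4)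
    (v : vertex G) (r s t : R) (hrst : triple_at v r s t) :
  has_sum
    (fun m : region G =>
       (height v m)%:R * ln (1 - (D - 4) / (label m ^+ 2 - 4)))
    (rho r + rho s + rho t).
Proof.
have [i [-> -> ->]] := hrst; have := @has_sum_term R G D hlabel hD hD4 v.
set c : corner G := (v, 0).
rewrite -[region_at v i]/(reg (v, i)) -[region_at v (i + 1)]/(reg (left (v, i))).
rewrite -[region_at v (i - 1)]/(reg (right (v, i))) -![label (reg _)]/(lab _).
(* The triple may start at any corner of [v]; the sum of the three values of [rho] is invariant
   under rotation. *)
have [->|->|->] := I3_cases 0 i => //.
- rewrite -[(v, 0 + 1)]/(left c) left_left right_left.
  by rewrite -addrA addrC.
- rewrite -[(v, 0 - 1)]/(right c) left_right right_right.
  by rewrite addrC addrA.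
Qed.
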